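(* Let $M$ be a smooth connected manifold, $\mu$ a measure on $M$ and $(P_t)_{t\ge0}$ a semigroup on $L^2(M,\mu)$ satisfying the diffusion axioms and the smooth first-order diffusion calculus described in the context, with carré du champ $\Gamma$. For $x\in M$ let $B_x$ be the symmetric bilinear form on $T_x^*M$ given by $B_x(\alpha,\beta):=\Gamma(f,h)(x)$, where $f,h\in C^\infty(M)$ are any functions with $df(x)=\alpha$, $dh(x)=\beta$. Assume that $B_x$ is positive definite for every $x\in M$. Then there exists a unique smooth Riemannian metric $g$ on $M$ such that for all $f,h\in C^\infty(M)$, $$\Gamma(f,h)=\langle df,dh\rangle_{g^{-1}}.$$ Equivalently, in any local coordinates $(x^i)$ one has $\Gamma(x^i,x^j)=g^{ij}$, where $(g^{ij})$ is the inverse of the coefficient matrix $(g_{ij})$ of $g$.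
   Context: Setting. $M$ is a smooth connected manifold, $\mu$ a $\sigma$-finite Borel measure on $M$ with full support, and $(P_t)_{t\ge0}$ a conservative symmetric Markov $C_0$-semigroup on $L^2(M,\mu)$ with self-adjoint generator $L$, $Lf=\lim_{t\downarrow0}(P_tf-f)/t$ in $L^2(\mu)$ for $f\in\mathrm{Dom}(L)$. Its Dirichlet form is $\mathcal E(f,h)=\lim_{t\downarrow0}\frac1t\langle f-P_tf,h\rangle_{L^2(\mu)}$, with domain $\mathcal D(\mathcal E)=\{f\in L^2(\mu):\mathcal E(f,f)<\infty\}$. Diffusion axioms. (D1) $0\le f\le1\Rightarrow0\le P_tf\le1$, and $P_t1=1$. (D2) $\int_M(P_tf)h\,d\mu=\int_Mf\,(P_th)\,d\mu$ for all $f,h\in L^2(M,\mu)$. (D3) Strong locality: $\mathcal E(f,h)=0$ whenever $f$ is constant on a neighbourhood of $\mathrm{supp}(h)$. (D4) Regularity: $\mathcal D(\mathcal E)\cap C_c(M)$ is dense in $\mathcal D(\mathcal E)$ for the norm $(\mathcal E(f,f)+\|f\|_{L^2}^2)^{1/2}$ and dense in $C_c(M)$ for the sup norm. (D5) $\mu$ is a smooth positive measure: locally $\mu=\rho\,dx$ with $\rho\in C^\infty$, $\rho>0$. Carré du champ. The semigroup is taken to act on $C^\infty(M)$, and for $f,h\in C^\infty(M)$, $$\Gamma(f,h):=\lim_{t\downarrow0}\frac1{2t}\big(P_t(fh)-(P_tf)(P_th)\big),\qquad \Gamma(f):=\Gamma(f,f).$$ Smooth first-order diffusion calculus. For all $f,h\in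 C^\infty(M)$ this limit exists pointwise and $\Gamma(f,h)\in C^\infty(M)$; $\Gamma$ is symmetric and bilinear; $\Gamma(f,h)(x)$ depends only on $df(x),dh(x)$; $\Gamma(f,h)=0$ if $h$ is constant near $\mathrm{supp}(f)$; Leibniz rule $\Gamma(f_1f_2,h)=f_1\Gamma(f_2,h)+f_2\Gamma(f_1,h)$, and likewise in the second slot; one-variable chain rule $\Gamma(\phi\circ f,h)=\phi'(f)\Gamma(f,h)$ for every smooth $\phi:\mathbb R\to\mathbb R$, and likewise in the second slot. Conventions. $\langle\cdot,\cdot\rangle_{g^{-1}}$ is the inner product on $T^*M$ dual to $g$. Since $\Gamma(f,h)(x)$ depends only on $df(x),dh(x)$, $B_x$ is well defined and $\Gamma$ makes sense on locally defined smooth functions such as coordinate functions. *)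

(* Defs.v *)
From HB Require Import structures.
From mathcomp Require Import all_boot all_order all_algebra.
From mathcomp Require Import all_classical all_reals all_analysis.

Set Implicit Arguments.
Unset Strict Implicit.
Unset Printing Implicit Defensive.

Import Order.TTheory GRing.Theory Num.Theory.
Import numFieldNormedType.Exports.

Local Open Scope classical_set_scope.
Local Open Scope ring_scope.

(** * Smooth manifolds *)

Section smooth_maps.
Context {R : realType} {V W : normedModType R}.

(* Only used for open [U].  [f] is C^(k+1) when it is Frechet differentiable
   and its differential is C^k; in finite dimension the latter amounts to all
   the directional derivatives of [f] being C^k. *)
Fixpoint Ck_on (k : nat) (U : set V) (f : V -> W) : Prop :=
  match k with
  | 0%N => forall x, U x -> {for x, continuous f}
  | k'.+1 => (forall x, U x -> differentiable f x) /\
             (forall v : V, Ck_on k' U ('D_v f))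
  end.

Definition smooth_on (U : set V) (f : V -> W) : Prop :=
  forall k, Ck_on k U f.

End smooth_maps.

(* [cmap] is meaningful on [cdom] only, and [cinv] on [cimg c] only. *)
Record chart (R : realType) (n : nat) (M : ptopologicalType) := Chart {
  cdom : set M;
  cmap : M -> 'rV[R]_n;
  cinv : 'rV[R]_n -> M }.

HB.instance Definition _ (R : realType) (n : nat) (M : ptopologicalType) :=
  gen_eqMixin (chart R n M).
HB.instance Definition _ (R : realType) (n : nat) (M : ptopologicalType) :=
  gen_choiceMixin (chart R n M).

Section manifolds.
Context {R : realType} {n : nat} {M : ptopologicalType}.
Implicit Types (c d : chart R n M) (A : set (chart R n M)).

Definition cimg c : set 'rV[R]_n := cmap c @` cdom c.

Record is_chart c : Prop := {
  chart_open_dom : open (cdom c);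
  chart_open_img : open (cimg c);
  chart_mapK : forall x, cdom c x -> cinv c (cmap c x) = x;
  chart_map_cts : forall x, cdom c x -> {for x, continuous (cmap c)};
  chart_inv_cts : forall y, cimg c y -> {for y, continuous (cinv c)} }.

Definition smooth_transition c d : Prop :=
  smooth_on (cmap c @` (cdom c `&` cdom d)) (cmap d \o cinv c).

(* A maximal smooth atlas, so that the charts of [A] are exactly the local
   coordinate systems of the manifold. *)
Record smooth_structure A : Prop := {
  atlas_chart : forall c, A c -> is_chart c;
  atlas_cover : forall x, exists2 c, A c & cdom c x;
  atlas_compat : forall c d, A c -> A d -> smooth_transition c d;
  atlas_max : forall c, is_chart c ->
    (forall d, A d -> smooth_transition c d /\ smooth_transition d c) -> A c }.

Record connected_smooth_manifold A : Prop := {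
  manifold_hausdorff : hausdorff_space M;
  manifold_second_countable : @second_countable M;
  manifold_connected : connected [set: M];
  manifold_smooth : smooth_structure A }.

Definition smooth_fun A (f : M -> R) : Prop :=
  forall c, A c -> smooth_on (cimg c) (f \o cinv c).

(* A chart of [A] around [x], chosen once and for all. *)
Definition chart_at A (x : M) : chart R n M :=
  xget (Chart setT (fun=> 0) (fun=> x)) [set c | A c /\ cdom c x].

(* The tangent space at [x] is R^n, a vector being identified with its
   components in [chart_at A x]; this is the only place where the chosen chart
   matters, and components in another chart follow from [coord_vec]. *)
Definition tangent_space A (x : M) : vectType R := 'rV[R]_n.

Definition cotangent_space A (x : M) : vectType R :=
  'Hom(tangent_space A x, R^o).

(* Also used for functions that are only smooth near [x]. *)
Definition dfun A (f : M -> R) (x : M) : cotangent_space A x :=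
  linfun ('d (f \o cinv (chart_at A x)) (cmap (chart_at A x) x)
          : 'rV[R]_n -> R^o).

Definition coord_fun c (i : 'I_n) : M -> R := fun y => cmap c y 0 i.

(* The coordinate vector field d/dx^i of [c]. *)
Definition coord_vec A c (i : 'I_n) (x : M) : tangent_space A x :=
  'D_(delta_mx 0 i) (cmap (chart_at A x) \o cinv c) (cmap c x).

Definition bilinear_form_field A :=
  forall x : M, tangent_space A x -> tangent_space A x -> R.

Definition gram_mx A (g : bilinear_form_field A) c (x : M) : 'M[R]_n :=
  \matrix_(i, j) g x (coord_vec A c i x) (coord_vec A c j x).

Record riemannian_metric A (g : bilinear_form_field A) : Prop := {
  metric_sym : forall x u v, g x u v = g x v u;
  metric_linear : forall x (a : R) u v w,
    g x (a *: u + v) w = a * g x u w + g x v w;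
  metric_posdef : forall x u, u != 0 -> 0 < g x u u;
  metric_smooth : forall c, A c -> forall i j,
    smooth_on (cimg c) (fun y => gram_mx g c (cinv c y) i j) }.

Definition sharp A (g : bilinear_form_field A) (x : M)
    (alpha : cotangent_space A x) : tangent_space A x :=
  xget 0 [set a | forall v, g x a v = alpha v].

Definition dual_metric A (g : bilinear_form_field A) (x : M)
    (alpha beta : cotangent_space A x) : R :=
  g x (sharp g alpha) (sharp g beta).

Definition tsupport (f : M -> R) : set M := closure [set x | f x != 0].

Definition Cc (f : M -> R) : Prop := continuous f /\ compact (tsupport f).

End manifolds.

(** * Borel measures *)

Notation borel M := (g_sigma_algebraType (@open M)).

(* Lebesgue integral over R^n of a nonnegative Borel function, as an iterated
   integral. *)
Fixpoint integral_rV (R : realType) (n : nat) :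
    ('rV[R]_n -> \bar R) -> \bar R :=
  match n with
  | 0%N => fun f => f 0
  | n'.+1 => fun f => (\int[lebesgue_measure]_t
      integral_rV (fun y : 'rV[R]_n' => f (row_mx (const_mx t : 'rV_1) y)))%E
  end.

Section measures.
Context {R : realType} {n : nat} {M : ptopologicalType}.
Variables (A : set (chart R n M)) (mu : {measure set (borel M) -> \bar R}).

Definition full_support : Prop :=
  forall U : set M, open U -> U !=set0 -> (0 < mu U)%E.

Definition smooth_positive_measure : Prop :=
  forall c, A c -> exists rho : 'rV[R]_n -> R,
    [/\ smooth_on (cimg c) rho,
        forall y, cimg c y -> 0 < rho y &
        forall B : set (borel M), measurable B -> B `<=` cdom c ->
          mu B = integral_rV (fun y => (\1_(cmap c @` B) y * rho y)%:E)].

Definition L2 (f : M -> R) : Prop := (f : borel M -> R) \in Lfun mu 2%:E.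

Definition L2norm (f : M -> R) : \bar R := 'N[mu]_2%:E [EFin \o f].

Definition L2inner (f h : M -> R) : R := \int[mu]_x (f x * h x).

Definition ae_equal (f h : M -> R) : Prop := {ae mu, forall x, f x = h x}.

(* Support of a class modulo null sets: the complement of the largest open set
   on which [f] vanishes almost everywhere. *)
Definition ae_support (f : M -> R) : set M :=
  ~` \bigcup_(U in [set U : set M | open U /\
                      {ae mu, forall x, U x -> f x = 0}]) U.

End measures.

(** * Semigroups *)

(* The operators of a semigroup [P] act on functions [M -> R], but only the
   functions in L^2 or in C^oo are constrained.  Statements about L^2 hold
   almost everywhere, statements about C^oo hold pointwise; using the same [P]
   for both makes the two actions agree on the intersection. *)
Section semigroups.
Context {R : realType} {n : nat} {M : ptopologicalType}.
Variables (A : set (chart R n M)) (mu : {measure set (borel M) -> \bar R}).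
Variable P : R -> (M -> R) -> (M -> R).
Implicit Types (f h : M -> R) (s t : R).

Local Notation L2 := (L2 mu).
Local Notation "f =ae h" := (ae_equal mu f h) (at level 70).

Record C0_semigroup_L2 : Prop := {
  sg_L2 : forall t f, 0 <= t -> L2 f -> L2 (P t f);
  sg_ae : forall t f h, 0 <= t -> L2 f -> L2 h -> f =ae h -> P t f =ae P t h;
  sg_linear : forall t (a : R) f h, 0 <= t -> L2 f -> L2 h ->
    P t (a *: f + h) =ae a *: P t f + P t h;
  sg_bounded : forall t, 0 <= t -> exists C : R, forall f, L2 f ->
    (L2norm mu (P t f) <= C%:E * L2norm mu f)%E;
  sg_0 : forall f, L2 f -> P 0 f =ae f;
  sg_add : forall s t f, 0 <= s -> 0 <= t -> L2 f ->
    P (s + t) f =ae P s (P t f);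
  sg_continuous : forall f, L2 f ->
    L2norm mu (P t f - f) @[t --> 0^'+] --> 0%E }.

Definition generator f h : Prop :=
  [/\ L2 f, L2 h &
      L2norm mu (t^-1 *: (P t f - f) - h) @[t --> 0^'+] --> 0%E].

(* Densely defined, and equal to its adjoint (equality of graphs). *)
Definition selfadjoint_generator : Prop :=
  (forall f (e : R), L2 f -> 0 < e ->
     exists u v, generator u v /\ (L2norm mu (f - u)%R < e%:E)%E) /\
  (forall f h, generator f h <->
     [/\ L2 f, L2 h &
         forall u v, generator u v -> L2inner mu v f = L2inner mu u h]).

Record semigroup_on_smooth : Prop := {
  smooth_sg : forall t f, 0 <= t -> smooth_fun A f -> smooth_fun A (P t f);
  smooth_sg_linear : forall t (a : R) f h, 0 <= t ->
    smooth_fun A f -> smooth_fun A h ->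
    P t (a *: f + h) = a *: P t f + P t h;
  smooth_sg_0 : forall f, smooth_fun A f -> P 0 f = f;
  smooth_sg_add : forall s t f, 0 <= s -> 0 <= t -> smooth_fun A f ->
    P (s + t) f = P s (P t f) }.

(* The constant 1 is smooth but not in L^2 when [mu] is infinite; there
   [conservative_L2] says that the extension of [P t] to bounded functions by
   monotone limits maps 1 to 1. *)
Record conservative_markov : Prop := {
  markov_L2 : forall t f, 0 <= t -> L2 f ->
    {ae mu, forall x, 0 <= f x <= 1} -> {ae mu, forall x, 0 <= P t f x <= 1};
  markov_smooth : forall t f, 0 <= t -> smooth_fun A f ->
    (forall x, 0 <= f x <= 1) -> forall x, 0 <= P t f x <= 1;
  conservative_smooth : forall t, 0 <= t -> P t (cst 1) = cst 1;
  conservative_L2 : forall t (u : nat -> M -> R), 0 <= t ->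
    (forall k, L2 (u k)) ->
    {ae mu, forall x, forall k, 0 <= u k x <= u k.+1 x} ->
    {ae mu, forall x, u k x @[k --> \oo] --> (1 : R)} ->
    {ae mu, forall x, P t (u k) x @[k --> \oo] --> (1 : R)} }.

Definition symmetric_semigroup : Prop :=
  forall t f h, 0 <= t -> L2 f -> L2 h ->
    L2inner mu (P t f) h = L2inner mu f (P t h).

Definition dirichlet f h : \bar R :=
  lim ((t^-1 * L2inner mu (f - P t f) h)%:E @[t --> 0^'+]).

Definition dirichlet_dom f : Prop := L2 f /\ (dirichlet f f < +oo)%E.

Definition strongly_local : Prop :=
  forall f h, dirichlet_dom f -> dirichlet_dom h ->
    (exists (U : set M) (a : R), [/\ open U, ae_support mu h `<=` U &
       {ae mu, forall x, U x -> f x = a}]) ->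
    dirichlet f h = 0%E.

Definition regular_dirichlet : Prop :=
  (forall f (e : R), dirichlet_dom f -> 0 < e ->
     exists u, [/\ dirichlet_dom u, Cc u &
       (dirichlet (f - u)%R (f - u)%R + (L2inner mu (f - u) (f - u))%:E
          < (e ^+ 2)%:E)%E]) /\
  (forall f (e : R), Cc f -> 0 < e ->
     exists u, [/\ dirichlet_dom u, Cc u & forall x, `|f x - u x| < e]).

Record diffusion_axioms : Prop := {
  diff_full_support : full_support mu;
  diff_C0 : C0_semigroup_L2;
  diff_selfadjoint : selfadjoint_generator;
  diff_smooth : semigroup_on_smooth;
  diff_markov : conservative_markov;
  diff_symmetric : symmetric_semigroup;
  diff_local : strongly_local;
  diff_regular : regular_dirichlet;
  diff_measure : smooth_positive_measure A mu }.

Definition gamma_quotient f h (x : M) (t : R) : R :=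
  (2 * t)^-1 * (P t (f * h) x - P t f x * P t h x).

Definition carre_du_champ f h : M -> R :=
  fun x => lim (gamma_quotient f h x t @[t --> 0^'+]).

Local Notation "'Gamma'" := carre_du_champ.
Local Notation smooth := (smooth_fun A).

Record smooth_diffusion_calculus : Prop := {
  gamma_cvg : forall f h x, smooth f -> smooth h ->
    cvg (gamma_quotient f h x t @[t --> 0^'+]);
  gamma_smooth : forall f h, smooth f -> smooth h -> smooth (Gamma f h);
  gamma_sym : forall f h, smooth f -> smooth h -> Gamma f h = Gamma h f;
  gamma_linear_l : forall (a : R) f1 f2 h,
    smooth f1 -> smooth f2 -> smooth h ->
    Gamma (a *: f1 + f2) h = a *: Gamma f1 h + Gamma f2 h;
  gamma_linear_r : forall (a : R) f h1 h2,
    smooth f -> smooth h1 -> smooth h2 ->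
    Gamma f (a *: h1 + h2) = a *: Gamma f h1 + Gamma f h2;
  gamma_first_order : forall f f' h h' x,
    smooth f -> smooth f' -> smooth h -> smooth h' ->
    dfun A f x = dfun A f' x -> dfun A h x = dfun A h' x ->
    Gamma f h x = Gamma f' h' x;
  gamma_local : forall f h, smooth f -> smooth h ->
    (exists (U : set M) (a : R), [/\ open U, tsupport f `<=` U &
       forall x, U x -> h x = a]) ->
    Gamma f h = 0;
  gamma_leibniz_l : forall f1 f2 h, smooth f1 -> smooth f2 -> smooth h ->
    Gamma (f1 * f2) h = f1 * Gamma f2 h + f2 * Gamma f1 h;
  gamma_leibniz_r : forall f h1 h2, smooth f -> smooth h1 -> smooth h2 ->
    Gamma f (h1 * h2) = h1 * Gamma f h2 + h2 * Gamma f h1;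
  gamma_chain_l : forall (phi : R -> R) f h, smooth_on setT phi ->
    smooth f -> smooth h ->
    Gamma (phi \o f) h = (derive1 phi \o f) * Gamma f h;
  gamma_chain_r : forall (phi : R -> R) f h, smooth_on setT phi ->
    smooth f -> smooth h ->
    Gamma f (phi \o h) = (derive1 phi \o h) * Gamma f h }.

Definition fun_with_differential x (alpha : cotangent_space A x) : M -> R :=
  xget 0 [set f | smooth f /\ dfun A f x = alpha].

(* The form B_x; the choice of representatives is immaterial by
   [gamma_first_order]. *)
Definition gamma_form x (alpha beta : cotangent_space A x) : R :=
  Gamma (fun_with_differential alpha) (fun_with_differential beta) x.

(* Gamma of two functions that are only smooth near [x]. *)
Definition local_gamma f h (x : M) : R :=
  gamma_form (dfun A f x) (dfun A h x).

Definition gamma_form_posdef : Prop :=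
  forall x (alpha : cotangent_space A x),
    alpha != 0 -> 0 < gamma_form alpha alpha.

End semigroups.

(* Main.v *)
(* A metric [g] satisfies Gamma(f, h) = <df, dh> if and only if, in the basis of
   the tangent space at every [x], its matrix is the inverse of the matrix of the
   form B_x: this determines [g] pointwise, and a change of basis gives the
   formula in coordinates.  For the smoothness of [g] near [x0], pick globally
   smooth f_1, ..., f_n whose differentials at [x0] form a basis.  With
   J_il = d f_l / d x^i and G_lm = Gamma(f_l, f_m), both smooth in the chart and
   G invertible near [x0], the coefficient matrix of [g] is J G^-1 J^T. *)

Require Import Defs.
From HB Require Import structures.
From mathcomp Require Import all_boot all_order all_algebra.
From mathcomp Require Import all_classical all_reals all_analysis.

Set Implicit Arguments.
Unset Strict Implicit.
Unset Printing Implicit Defensive.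

Import Order.TTheory GRing.Theory Num.Theory.
Import numFieldNormedType.Exports.

Local Open Scope classical_set_scope.
Local Open Scope ring_scope.

(** * Functions of class C^k on open sets, and smooth matrix-valued maps *)

Section smooth_calculus.
Context {R : realType} {V : normedModType R}.
Implicit Types (U : set V) (x v : V).

(** The first-order expansion sees only the germ at [x]: [g] inherits the expansion of [f], and
    uniqueness of the differential identifies ['d g x] with ['d f x]. *)
Lemma near_eq_differentiable (W : normedModType R) (f g : V -> W) x :
  (\forall y \near x, f y = g y) -> differentiable f x -> differentiable g x.
Proof.
move=> fg df; have fgx := nbhs_singleton fg.
have key : g \o shift x = cst (g x) + 'd f x +o_ 0 id.
  apply/eqaddoP => _/posnumP[e].
  have /eqaddoP/(_ _ (gt0 e)) := diff_locally df.
  have : \forall h \near (0 : V), f (h + x) = g (h + x).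
    by move: (fg); rewrite (near_shift 0 x) subr0.
  apply: filterS2 => h /= fgh; rewrite /cst /= -fgx.
  by rewrite !fctE /= fgh.
have dg : 'd g x = 'd f x :> (V -> W).
  by apply: diff_unique => //; exact: diff_continuous.
apply/diff_locallyP; split; first by rewrite dg; exact: diff_continuous.
by rewrite key dg.
Qed.

Lemma Ck_on_subset (W : normedModType R) k U U' (f : V -> W) :
  U' `<=` U -> Ck_on k U f -> Ck_on k U' f.
Proof.
move=> sub; elim: k f => [|k IH] f /=; first by move=> h x /sub/h.
by move=> [h1 h2]; split=> [x /sub/h1//|v]; exact: IH.
Qed.

(** [Ck_on] differentiates in the ambient space and imposes conditions only at the points of [U], so
    it splits into conditions on singletons. This permits a different local argument at each
    point. *)
Lemma Ck_on_points (W : normedModType R) k U (f : V -> W) :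
  (forall x, U x -> Ck_on k [set x] f) -> Ck_on k U f.
Proof.
elim: k f => [|k IH] f /= h; first by move=> x /h; apply.
split=> [x /h[+ _]|v]; first exact.
by apply: IH => x /h[].
Qed.

Lemma near_eq_Ck_on (W : normedModType R) k U (f g : V -> W) :
  (forall x, U x -> \forall y \near x, f y = g y) ->
  Ck_on k U f -> Ck_on k U g.
Proof.
elim: k f g => [|k IH] f g fg /=.
  move=> h x Ux; have fgx := fg _ Ux.
  rewrite /prop_for /continuous_at -(nbhs_singleton fgx).
  by apply: cvg_trans (h _ Ux); apply: near_eq_cvg.
move=> [h1 h2]; split=> [x Ux|v].
  exact: near_eq_differentiable (fg _ Ux) (h1 _ Ux).
apply: IH (h2 v) => x Ux.
(* Agreement near [x] gives agreement near every [y] close to [x], so the directional derivatives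
   also agree near [x]. *)
have /near_join := fg _ Ux.
by apply: filterS => y; exact: near_eq_derive.
Qed.

Lemma Ck_onW (W : normedModType R) k U (f : V -> W) :
  Ck_on k.+1 U f -> Ck_on k U f.
Proof.
elim: k f => [|k IH] f; first by move=> [h _] x /h; exact: differentiable_continuous.
by move=> [h1 h2]; split=> // v; apply: IH; exact: h2.
Qed.

Lemma Ck_on_cst (W : normedModType R) k U (a : W) : Ck_on k U (cst a).
Proof.
elim: k a => [|k IH] a /=; first by move=> x _; exact: cst_continuous.
split=> [x _|v]; first exact: differentiable_cst.
suff -> : 'D_v (cst a : V -> W) = cst 0 by exact: IH.
by apply/funext => y; rewrite derive_cst.
Qed.

Lemma Ck_onD (W : normedModType R) k U (f g : V -> W) : open U ->
  Ck_on k U f -> Ck_on k U g -> Ck_on k U (f + g).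
Proof.
move=> oU; elim: k f g => [|k IH] f g /=.
  by move=> hf hg x Ux; apply: cvgD; [exact: hf|exact: hg].
move=> [f1 f2] [g1 g2]; split=> [x Ux|v].
  by apply: differentiableD; [exact: f1|exact: g1].
(* The derivative of a sum is computed at points of [U] only; openness turns this into an equality
   near each of them. *)
apply: near_eq_Ck_on (IH _ _ (f2 v) (g2 v)) => x Ux.
have : \forall y \near x, U y by exact: open_nbhs_nbhs.
apply: filterS => y Uy; rewrite deriveD //; apply: diff_derivable.
  exact: f1.
exact: g1.
Qed.

Lemma Ck_onM k U (f g : V -> R) : open U ->
  Ck_on k U f -> Ck_on k U g -> Ck_on k U (f * g).
Proof.
move=> oU; elim: k f g => [|k IH] f g.
  by move=> hf hg x Ux; apply: cvgM; [exact: hf|exact: hg].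
move=> Cf Cg; have [f1 f2] := Cf; have [g1 g2] := Cg; split=> [x Ux|v].
  by apply: differentiableM; [exact: f1|exact: g1].
have CD := Ck_onD oU (IH _ _ (Ck_onW Cf) (g2 v)) (IH _ _ (Ck_onW Cg) (f2 v)).
apply: near_eq_Ck_on CD => x Ux.
have : \forall y \near x, U y by exact: open_nbhs_nbhs.
apply: filterS => y Uy; rewrite deriveM //; apply: diff_derivable.
  exact: f1.
exact: g1.
Qed.

Lemma Ck_onV k U (f : V -> R) : open U -> (forall x, U x -> f x != 0) ->
  Ck_on k U f -> Ck_on k U (fun x => (f x)^-1).
Proof.
move=> oU f0; elim: k => [|k IH].
  by move=> hf x Ux; apply: cvgV; [exact: f0|exact: hf].
move=> Cf; have [f1 f2] := Cf; split=> [x Ux|v].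
  by apply: differentiableV; [exact: f1|exact: f0].
have Ci := IH (Ck_onW Cf).
(* This product is [- f^-2 * 'D_v f], the derivative of the inverse; it is C^k by the induction
   hypothesis on [f^-1]. *)
have CN := Ck_onM oU (Ck_on_cst k U (-1 : R)) (Ck_onM oU (Ck_onM oU Ci Ci) (f2 v)).
apply: near_eq_Ck_on CN => x Ux.
have : \forall y \near x, U y by exact: open_nbhs_nbhs.
apply: filterS => y Uy; rewrite deriveV //; first last.
- by apply: diff_derivable; exact: f1.
- exact: f0.
by rewrite !fctE /cst /= -expr2 exprVn mulN1r scaleNr.
Qed.

Lemma smooth_on_sum U I (r : seq I) (Q : pred I) (f : I -> V -> R) : open U ->
  (forall i, Q i -> smooth_on U (f i)) ->
  smooth_on U (fun x => \sum_(i <- r | Q i) f i x).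
Proof.
move=> oU fU k; have -> : (fun x => \sum_(i <- r | Q i) f i x) =
    \sum_(i <- r | Q i) f i by apply/funext => x; rewrite fct_sumE.
by elim/big_ind: _ => [|? ?|i /fU//]; [exact: Ck_on_cst|exact: Ck_onD].
Qed.

Lemma smooth_on_prod U I (r : seq I) (Q : pred I) (f : I -> V -> R) : open U ->
  (forall i, Q i -> smooth_on U (f i)) ->
  smooth_on U (fun x => \prod_(i <- r | Q i) f i x).
Proof.
move=> oU fU k; have -> : (fun x => \prod_(i <- r | Q i) f i x) =
    \prod_(i <- r | Q i) f i by apply/funext => x; rewrite fct_prodE.
by elim/big_ind: _ => [|? ?|i /fU//]; [exact: Ck_on_cst|exact: Ck_onM].
Qed.

Definition smooth_mx_on U m n (F : V -> 'M[R]_(m, n)) : Prop :=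
  forall i j, smooth_on U (fun x => F x i j).

Lemma smooth_mx_on_subset U U' m n (F : V -> 'M[R]_(m, n)) :
  U' `<=` U -> smooth_mx_on U F -> smooth_mx_on U' F.
Proof. by move=> sub FU i j k; apply: Ck_on_subset (FU i j k). Qed.

Lemma smooth_mx_on_tr U m n (F : V -> 'M[R]_(m, n)) :
  smooth_mx_on U F -> smooth_mx_on U (fun x => (F x)^T).
Proof.
move=> FU i j; rewrite (_ : (fun x => (F x)^T i j) = (fun x => F x j i)) //.
by apply/funext => x; rewrite mxE.
Qed.

Lemma smooth_mx_on_mul U m n p (F : V -> 'M[R]_(m, n)) (G : V -> 'M[R]_(n, p)) :
  open U -> smooth_mx_on U F -> smooth_mx_on U G ->
  smooth_mx_on U (fun x => F x *m G x).
Proof.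
move=> oU FU GU i j.
rewrite (_ : (fun x => _) = fun x => \sum_l F x i l * G x l j).
  by apply: smooth_on_sum => // l _ k; apply: Ck_onM (FU i l k) (GU l j k).
by apply/funext => x; rewrite mxE.
Qed.

Lemma smooth_mx_on_det U n (F : V -> 'M[R]_n) :
  open U -> smooth_mx_on U F -> smooth_on U (fun x => \det (F x)).
Proof.
move=> oU FU; rewrite /determinant; apply: smooth_on_sum => // s _ k.
apply: Ck_onM => //; first exact: Ck_on_cst.
by apply: smooth_on_prod.
Qed.

(** Cramer's rule: the entries are cofactors, with transposed indices, divided by the
    determinant. *)
Lemma smooth_mx_on_inv U n (F : V -> 'M[R]_n) :
  open U -> (forall x, U x -> F x \in unitmx) -> smooth_mx_on U F ->
  smooth_mx_on U (fun x => invmx (F x)).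
Proof.
move=> oU uF FU i j k.
have detU := smooth_mx_on_det oU FU.
have det0 x : U x -> \det (F x) != 0 by move=> /uF; rewrite unitmxE unitfE.
have cofU : smooth_on U (fun x => cofactor (F x) j i).
  move=> l; rewrite /cofactor; apply: Ck_onM => //; first exact: Ck_on_cst.
  apply: smooth_mx_on_det => // a b.
  rewrite (_ : (fun x => _) = (fun x => F x (lift j a) (lift i b))) //.
  by apply/funext => x; rewrite !mxE.
apply: near_eq_Ck_on (Ck_onM oU (Ck_onV oU det0 (detU k)) (cofU k)) => x Ux.
have : \forall y \near x, U y by exact: open_nbhs_nbhs.
by apply: filterS => y Uy; rewrite /invmx uF// !mxE.
Qed.

End smooth_calculus.

(** * Bilinear forms as matrices, and changes of basis *)

Section bilinear_forms.
Context {R : realFieldType} {n : nat}.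
Implicit Types (u v : 'rV[R]_n) (S : 'M[R]_n).

Lemma symmetric_bilinear_mxE (b : 'rV[R]_n -> 'rV[R]_n -> R) u v :
  (forall u v, b u v = b v u) ->
  (forall a u v w, b (a *: u + v) w = a * b u w + b v w) ->
  b u v = (u *m (\matrix_(i, j) b (delta_mx 0 i) (delta_mx 0 j)) *m v^T) 0 0.
Proof.
move=> bC bl.
have b0 w : b 0 w = 0.
  (* Linearity applied to [1 *: 0 + 0] reads [b 0 w = b 0 w + b 0 w]. *)
  by have /eqP := bl 1 0 0 w; rewrite scaler0 addr0 mul1r addrC -subr_eq subrr => /eqP.
have bsum (w z : 'rV[R]_n) : b w z = \sum_i w 0 i * b (delta_mx 0 i) z.
  rewrite {1}[w]row_sum_delta; elim/big_rec2: _ => [|i y1 y2 _ <-]; first exact: b0.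
  exact: bl.
rewrite -mulmxA mxE bsum; apply: eq_bigr => i _; congr (_ * _).
by rewrite bC bsum mxE; apply: eq_bigr => j _; rewrite !mxE mulrC bC.
Qed.

(** A nonzero vector in the left kernel of [S] would have value 0 under the form. *)
Lemma posdef_unitmx S :
  (forall u, u != 0 -> 0 < (u *m S *m u^T) 0 0) -> S \in unitmx.
Proof.
move=> Spos; rewrite -row_free_unit; apply: inj_row_free => v vS.
apply/eqP; apply: contraT => /Spos; by rewrite vS mul0mx mxE ltxx.
Qed.

Lemma mulmx_trE m p (X : 'M[R]_(m, n)) (Y : 'M[R]_(p, n)) S i j :
  (X *m S *m Y^T) i j = (row i X *m S *m (row j Y)^T) 0 0.
Proof. by rewrite -row_mul !mxE; apply: eq_bigr => k _; rewrite !mxE. Qed.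

Lemma mulmx_delta_trE S i j :
  ((delta_mx 0 i : 'rV_n) *m S *m (delta_mx 0 j : 'rV_n)^T) 0 0 = S i j.
Proof. by rewrite trmx_delta -rowE -colE !mxE. Qed.

(** The rows of [E] are a basis and those of [X] its dual basis; the inverse of a Gram matrix is the
    Gram matrix of the dual form in the dual basis. *)
Lemma invmx_dual_basis (E X S : 'M[R]_n) : S \in unitmx -> E *m X^T = 1%:M ->
  invmx (E *m S *m E^T) = X *m invmx S *m X^T.
Proof.
move=> uS EX.
have XE : X^T *m E = 1%:M by exact: mulmx1C.
have uE : E \in unitmx by have [] := mulmx1_unit EX.
have uG : E *m S *m E^T \in unitmx by rewrite !unitmx_mul uE uS unitmx_tr.
have EXT : E^T *m X = 1%:M by rewrite -[E^T *m X]trmxK trmx_mul trmxK XE trmx1.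
suff H : (E *m S *m E^T) *m (X *m invmx S *m X^T) = 1%:M.
  by rewrite -[RHS](mulKmx uG) H mulmx1.
rewrite !mulmxA -(mulmxA _ E^T X) EXT mulmx1 -(mulmxA E S) mulmxV // mulmx1.
exact: EX.
Qed.

(** This is the formula J G^-1 J^T: [S] is a form on covectors, the rows of [F] are covectors with
    Gram matrix G, and J = [E *m F^T] pairs the vectors in [E] with them. Invertibility of G forces
    that of [F] and [S]. *)
Lemma invmx_change_basis (E F S : 'M[R]_n) :
  F *m S *m F^T \in unitmx ->
  (E *m F^T) *m invmx (F *m S *m F^T) *m (E *m F^T)^T = E *m invmx S *m E^T.
Proof.
rewrite !unitmx_mul => /andP[/andP[uF uS] uFT].
have -> : invmx (F *m S *m F^T) = invmx F^T *m invmx S *m invmx F.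
  have uG : F *m S *m F^T \in unitmx by rewrite !unitmx_mul uF uS uFT.
  apply: (can_inj (mulKmx uG)); rewrite mulmxV // !mulmxA mulmxK //.
  by rewrite -(mulmxA F S) mulmxV // mulmx1 mulmxV.
by rewrite trmx_mul trmxK !mulmxA mulmxK // -(mulmxA _ (invmx F) F) mulVmx // mulmx1.
Qed.

End bilinear_forms.

(** * Covectors as row vectors *)

Section covectors.
Context {R : realType} {n : nat} {M : ptopologicalType}.
Context (A : set (chart R n M)).
Implicit Types (x : M).

Definition covector_row x (alpha : cotangent_space A x) : 'rV[R]_n :=
  \row_i alpha (delta_mx 0 i).

Lemma covectorE x (alpha : cotangent_space A x) (v : 'rV[R]_n) :
  alpha v = (v *m (covector_row alpha)^T) 0 0.
Proof.
rewrite {1}[v]row_sum_delta linear_sum mxE; apply: eq_bigr => i _.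
by rewrite linearZ !mxE.
Qed.

Lemma covector_row_inj x : injective (@covector_row x).
Proof. by move=> a b ab; apply/lfunP => v; rewrite !covectorE ab. Qed.

Lemma covector_row_linear x (a : R) (alpha beta : cotangent_space A x) :
  covector_row (a *: alpha + beta) = a *: covector_row alpha + covector_row beta.
Proof. by apply/rowP => i; rewrite !mxE add_lfunE scale_lfunE. Qed.

Lemma mulmx_tr_linear (w : 'rV[R]_n) :
  linear (fun v : 'rV[R]_n => (v *m w^T) 0 0 : R^o).
Proof. by move=> a u v; rewrite mulmxDl -scalemxAl !mxE. Qed.

Lemma covector_row_surj x (w : 'rV[R]_n) :
  {alpha : cotangent_space A x | covector_row alpha = w}.
Proof.
pose l : {linear 'rV[R]_n -> R^o} := HB.pack (fun v : 'rV[R]_n => (v *m w^T) 0 0 : R^o)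
  (GRing.isLinear.Build _ _ _ _ _ (mulmx_tr_linear w)).
exists (linfun l); apply/rowP => i.
by rewrite mxE lfunE /= -rowE !mxE.
Qed.

Definition row_covector x (w : 'rV[R]_n) : cotangent_space A x :=
  sval (covector_row_surj x w).

Lemma row_covectorK x (w : 'rV[R]_n) : covector_row (row_covector x w) = w.
Proof. exact: svalP (covector_row_surj x w). Qed.

Lemma covector_row_eq0 x (alpha : cotangent_space A x) :
  (covector_row alpha == 0) = (alpha == 0).
Proof.
have r0 : covector_row (0 : cotangent_space A x) = 0.
  by apply/rowP => i; rewrite !mxE lfunE.
by apply/eqP/eqP => [h|->//]; apply: covector_row_inj; rewrite h r0.
Qed.

End covectors.

(** * Matrices of a metric and of its dual *)

Section metrics.
Context {R : realType} {n : nat} {M : ptopologicalType}.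
Context (A : set (chart R n M)).
Implicit Types (g : bilinear_form_field A) (c : chart R n M) (x : M).

Definition form_mx g x : 'M[R]_n :=
  \matrix_(i, j) @g x (delta_mx 0 i) (delta_mx 0 j).

(** The transposed Jacobian of the transition from [c] to [chart_at A x]. *)
Definition coord_mx c x : 'M[R]_n := \matrix_(i < n) (coord_vec A c i x : 'rV[R]_n).

Section one_metric.
Variable g : bilinear_form_field A.
Hypothesis gR : riemannian_metric g.

Lemma metric_form_mxE x (u v : 'rV[R]_n) :
  @g x u v = (u *m form_mx g x *m v^T) 0 0.
Proof.
apply: symmetric_bilinear_mxE => [w z|a w z t]; first exact (Defs.metric_sym gR w z).
exact (metric_linear gR a w z t).
Qed.

Lemma form_mx_unit x : form_mx g x \in unitmx.
Proof.
by apply: posdef_unitmx => u u0; rewrite -metric_form_mxE; exact: (metric_posdef gR).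
Qed.

Lemma gram_coord_mxE c x :
  gram_mx g c x = coord_mx c x *m form_mx g x *m (coord_mx c x)^T.
Proof.
by apply/matrixP => i j; rewrite mxE metric_form_mxE [RHS]mulmx_trE !rowK.
Qed.

Lemma dual_metricE x (alpha beta : cotangent_space A x) :
  dual_metric g alpha beta =
  (covector_row alpha *m invmx (form_mx g x) *m (covector_row beta)^T) 0 0.
Proof.
have uG := form_mx_unit x.
(* [sharp] is an [xget] with default 0, so a representing vector must be exhibited; invertibility of
   [form_mx g x] supplies it. *)
have sharpE (a : cotangent_space A x) v : @g x (sharp g a) v = a v.
  have : exists w, forall v, @g x w v = a v.
    exists (covector_row a *m invmx (form_mx g x)) => w.
    rewrite metric_form_mxE mulmxKV // covectorE.
    by rewrite [LHS]mxE [RHS]mxE; apply: eq_bigr => i _; rewrite !mxE mulrC.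
  by move=> /(xgetPex 0); exact.
have srow : sharp g alpha = covector_row alpha *m invmx (form_mx g x).
  rewrite -[LHS](mulmxK uG); congr (_ *m _); apply/rowP => i.
  by rewrite [RHS]mxE -sharpE metric_form_mxE trmx_delta -colE [RHS]mxE.
by rewrite /dual_metric (Defs.metric_sym gR) sharpE covectorE srow.
Qed.

End one_metric.

End metrics.

(** * Differentials and coordinate vectors in charts *)

Section differentials.
Context {R : realType} {n : nat} {M : ptopologicalType}.
Variable A : set (chart R n M).
Hypothesis smoothA : smooth_structure A.
Implicit Types (c : chart R n M) (x : M) (f h : M -> R).

Lemma chart_atP x : A (chart_at A x) /\ cdom (chart_at A x) x.
Proof.
rewrite /chart_at; apply: (@xgetPex _ _ [set c | A c /\ cdom c x]).
by have [c Ac cx] := atlas_cover smoothA x; exists c.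
Qed.

Lemma near_cinv_cdom c d x : A c -> A d -> cdom c x -> cdom d x ->
  \forall y \near cmap c x, cimg c y /\ cdom d (cinv c y).
Proof.
move=> Ac Ad cx dx.
have [_ oi mK _ ic] := atlas_chart smoothA Ac.
have [od _ _ _ _] := atlas_chart smoothA Ad.
have imx : cimg c (cmap c x) by exists x.
apply: filterI; first exact: open_nbhs_nbhs.
by apply: (ic _ imx); rewrite mK//; exact: open_nbhs_nbhs.
Qed.

Lemma cinvK c y : A c -> cimg c y -> cmap c (cinv c y) = y /\ cdom c (cinv c y).
Proof.
move=> Ac [x cx <-]; have [_ _ mK _ _] := atlas_chart smoothA Ac.
by rewrite mK.
Qed.

Lemma transition_differentiable c d x : A c -> A d -> cdom c x -> cdom d x ->
  differentiable (cmap d \o cinv c) (cmap c x).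
Proof.
move=> Ac Ad cx dx; apply: (proj1 (atlas_compat smoothA Ac Ad 1%N)).
by exists x.
Qed.

Lemma smooth_fun_differentiable f c x : A c -> cdom c x -> smooth_fun A f ->
  differentiable (f \o cinv c) (cmap c x).
Proof. by move=> Ac cx /(_ c Ac 1%N)[+ _]; apply; exists x. Qed.

Lemma coord_fun_differentiable c d x (i : 'I_n) :
  A c -> A d -> cdom c x -> cdom d x ->
  differentiable (coord_fun c i \o cinv d) (cmap d x).
Proof.
move=> Ac Ad cx dx.
apply: (@differentiable_comp _ _ _ _ (cmap c \o cinv d) (fun y => y 0 i)).
  exact: transition_differentiable.
exact: differentiable_coord.
Qed.

(** Weaker than [smooth_fun], so as to cover coordinate functions, which are meaningful only on the
    domain of their chart. *)
Definition differentiable_at f x :=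
  differentiable (f \o cinv (chart_at A x)) (cmap (chart_at A x) x).

Lemma dfunE f x (v : 'rV[R]_n) :
  dfun A f x v = 'd (f \o cinv (chart_at A x)) (cmap (chart_at A x) x) v.
Proof. by rewrite /dfun lfunE. Qed.

(** Chain rule through the transition map from [c] to [chart_at A x]; the factorization of
    [f \o cinv c] through it holds near [cmap c x]. *)
Lemma dfun_coord_vec f c x (i : 'I_n) : A c -> cdom c x -> differentiable_at f x ->
  dfun A f x (coord_vec A c i x) = 'D_(delta_mx 0 i) (f \o cinv c) (cmap c x).
Proof.
move=> Ac cx; rewrite /differentiable_at dfunE /coord_vec.
have [] := chart_atP x; move: (chart_at A x) => d Ad dx df.
have [_ _ mK _ _] := atlas_chart smoothA Ac.
have [_ _ dK _ _] := atlas_chart smoothA Ad.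
have dt : differentiable (cmap d \o cinv c) (cmap c x).
  exact: transition_differentiable.
have dtE : (cmap d \o cinv c) (cmap c x) = cmap d x by rewrite /= mK.
have df' : differentiable (f \o cinv d) ((cmap d \o cinv c) (cmap c x)).
  by rewrite dtE.
have -> : 'D_(delta_mx 0 i) (f \o cinv c) (cmap c x) =
    'D_(delta_mx 0 i) ((f \o cinv d) \o (cmap d \o cinv c)) (cmap c x).
  apply: near_eq_derive; have := near_cinv_cdom Ac Ad cx dx.
  by apply: filterS => y [_ dy] /=; rewrite dK.
rewrite [RHS]deriveE; last exact: differentiable_comp.
apply: esym; apply: (eq_trans (congr1 (@^~ (delta_mx 0 i)) (diff_comp dt df'))).
by cbv beta; rewrite (deriveE _ dt) dtE.
Qed.

Lemma dfun_linear (a : R) f h x : differentiable_at f x -> differentiable_at h x ->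
  dfun A (a *: f + h) x = a *: dfun A f x + dfun A h x.
Proof.
move=> df dh; apply/lfunP => v; rewrite add_lfunE scale_lfunE !dfunE.
have -> : (a *: f + h) \o cinv (chart_at A x) =
  a *: (f \o cinv (chart_at A x)) + (h \o cinv (chart_at A x)) by [].
have dZ := diffZ a df.
have daf := differentiableZ a df.
have dD := diffD daf dh.
apply: (eq_trans (congr1 (@^~ v) dD)); cbv beta => /=.
congr (_ + _); exact: (congr1 (@^~ v) dZ).
Qed.

Lemma dfun_cst (a : R) x : dfun A (cst a) x = 0.
Proof. by apply/lfunP => v; rewrite dfunE (diff_cst a) lfunE. Qed.

Lemma smooth_fun_linear (a : R) f h :
  smooth_fun A f -> smooth_fun A h -> smooth_fun A (a *: f + h).
Proof.
move=> sf sh c Ac k.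
have oc := chart_open_img (atlas_chart smoothA Ac).
exact: Ck_onD oc (Ck_onM oc (Ck_on_cst k _ a) (sf c Ac k)) (sh c Ac k).
Qed.

Lemma smooth_fun_cst (a : R) : smooth_fun A (cst a).
Proof. by move=> c Ac k; exact: Ck_on_cst. Qed.

Lemma smooth_differentiable_at f x : smooth_fun A f -> differentiable_at f x.
Proof. by have [Ad dx] := chart_atP x; exact: smooth_fun_differentiable. Qed.

Definition dcoord_mx c x : 'M[R]_n :=
  \matrix_(i < n) covector_row (dfun A (coord_fun c i) x).

(** The entries are the partial derivatives of x^j along x^i: read in [c], the function x^j is
    locally a linear projection, hence its own differential. *)
Lemma coord_mx_dual c x : A c -> cdom c x ->
  coord_mx A c x *m (dcoord_mx c x)^T = 1%:M.
Proof.
move=> Ac cx; have [Ad dx] := chart_atP x; apply/matrixP => i j.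
rewrite -[coord_mx A c x]mulmx1 mulmx_trE !rowK mulmx1 -covectorE.
rewrite dfun_coord_vec //; last exact: coord_fun_differentiable.
have -> : 'D_(delta_mx 0 i) (coord_fun c j \o cinv c) (cmap c x) =
    'D_(delta_mx 0 i) (fun y : 'rV[R]_n => y 0 j) (cmap c x).
  apply: near_eq_derive; have := near_cinv_cdom Ac Ac cx cx.
  by apply: filterS => y [yc _]; rewrite /coord_fun /= (cinvK Ac yc).1.
rewrite deriveE; last exact: differentiable_coord.
have lin : linear (fun y : 'rV[R]_n => y 0 j : R^o) by move=> a u v; rewrite !mxE.
pose l : {linear 'rV[R]_n -> R^o} := HB.pack (fun y : 'rV[R]_n => y 0 j : R^o)
  (GRing.isLinear.Build _ _ _ _ _ lin).
have dl := diff_lin (f := l) (cmap c x) (@coord_continuous R 1 n 0 j).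
apply: (eq_trans (congr1 (@^~ (delta_mx 0 i)) dl)).
by rewrite /= !mxE eqxx eq_sym.
Qed.

End differentials.

(** * The form B_x and its matrix *)

Section gamma.
Context {R : realType} {n : nat} {M : ptopologicalType}.
Variables (A : set (chart R n M)) (P : R -> (M -> R) -> (M -> R)).
Hypothesis smoothA : smooth_structure A.
Hypothesis calculus : smooth_diffusion_calculus A P.
Hypothesis posdef : gamma_form_posdef A P.
Implicit Types (c : chart R n M) (x : M) (f h : M -> R) (g : bilinear_form_field A).

Local Notation Gamma := (carre_du_champ P).

Lemma gamma0l h : smooth_fun A h -> Gamma 0 h = 0.
Proof.
move=> sh; have s0 : smooth_fun A 0 := smooth_fun_cst 0.
have := gamma_linear_l calculus 1 s0 s0 sh.
by rewrite !scale1r addr0 => /eqP; rewrite addrC -subr_eq subrr => /eqP.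
Qed.

(* If no smooth function had differential [alpha != 0], the junk value [0] of
   [fun_with_differential] would give [gamma_form alpha alpha = 0]; so positive
   definiteness replaces the usual cut-off functions. *)
Lemma fun_with_differentialP x (alpha : cotangent_space A x) :
  smooth_fun A (fun_with_differential alpha) /\
  dfun A (fun_with_differential alpha) x = alpha.
Proof.
have s0 : smooth_fun A 0 := smooth_fun_cst 0.
apply: (@xgetPex _ _ [set f | smooth_fun A f /\ dfun A f x = alpha]).
have [->|alpha0] := eqVneq alpha 0.
  by exists 0; split => //; exact: dfun_cst.
apply: contrapT => nex.
have := posdef alpha0; rewrite /gamma_form.
suff -> : fun_with_differential alpha = 0 by rewrite gamma0l // ltxx.
by apply: xgetPN => f fP; apply: nex; exists f.
Qed.

Lemma gamma_formE f h x : smooth_fun A f -> smooth_fun A h ->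
  Gamma f h x = gamma_form P (dfun A f x) (dfun A h x).
Proof.
move=> sf sh; have [sF dF] := fun_with_differentialP (dfun A f x).
have [sH dH] := fun_with_differentialP (dfun A h x).
by apply: (gamma_first_order calculus).
Qed.

(** The matrix of B_x in the basis dual to the standard basis of [tangent_space A x]. *)
Definition gamma_mx x : 'M[R]_n := \matrix_(i, j)
  gamma_form P (row_covector A x (delta_mx 0 i)) (row_covector A x (delta_mx 0 j)).

(** B_x inherits bilinearity from Gamma: a linear combination of representatives has the combined
    differential, and the choice of representative is immaterial. *)
Lemma gamma_form_mxE x (alpha beta : cotangent_space A x) :
  gamma_form P alpha beta =
  (covector_row alpha *m gamma_mx x *m (covector_row beta)^T) 0 0.
Proof.
pose b u v := gamma_form P (row_covector A x u) (row_covector A x v).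
have -> : gamma_form P alpha beta = b (covector_row alpha) (covector_row beta).
  by congr (gamma_form P); apply: covector_row_inj; rewrite row_covectorK.
rewrite /gamma_mx; apply: (symmetric_bilinear_mxE (b := b)) => [u v|a u v w].
  have [su _] := fun_with_differentialP (row_covector A x u).
  have [sv _] := fun_with_differentialP (row_covector A x v).
  by rewrite /b /gamma_form (gamma_sym calculus).
have [su du] := fun_with_differentialP (row_covector A x u).
have [sv dv] := fun_with_differentialP (row_covector A x v).
have [sw dw] := fun_with_differentialP (row_covector A x w).
have -> : b (a *: u + v) w =
    Gamma (a *: fun_with_differential (row_covector A x u) +
      fun_with_differential (row_covector A x v))
      (fun_with_differential (row_covector A x w)) x.
  rewrite gamma_formE ?dw ?dfun_linear ?du ?dv //; last 3 first.
  - exact: smooth_differentiable_at.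
  - exact: smooth_differentiable_at.
  - exact: smooth_fun_linear.
  congr (gamma_form P); apply: covector_row_inj.
  by rewrite covector_row_linear !row_covectorK.
by rewrite (gamma_linear_l calculus).
Qed.

Lemma gamma_mx_posdef x (u : 'rV[R]_n) : u != 0 -> 0 < (u *m gamma_mx x *m u^T) 0 0.
Proof.
move=> u0; rewrite -{1 2}[u](row_covectorK A x) -gamma_form_mxE.
by apply: posdef; rewrite -covector_row_eq0 row_covectorK.
Qed.

Lemma gamma_mx_unit x : gamma_mx x \in unitmx.
Proof. exact: posdef_unitmx (@gamma_mx_posdef x). Qed.

Lemma gamma_mx_sym x : (gamma_mx x)^T = gamma_mx x.
Proof.
apply/matrixP => i j; rewrite !mxE /gamma_form.
by rewrite (gamma_sym calculus) //; exact: (fun_with_differentialP _).1.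
Qed.

(** Both sides are bilinear in the differentials, and every covector is the differential of a smooth
    function, so it suffices to compare on basis covectors. *)
Lemma gamma_dual_metricP g : riemannian_metric g ->
  (forall f h, smooth_fun A f -> smooth_fun A h -> forall x,
     Gamma f h x = dual_metric g (dfun A f x) (dfun A h x)) <->
  (forall x, gamma_mx x = invmx (form_mx g x)).
Proof.
move=> gR; split=> [Gg x|Gg f h sf sh x]; last first.
  by rewrite gamma_formE // gamma_form_mxE dual_metricE // Gg.
apply/matrixP => i j.
have [sf df] := fun_with_differentialP (row_covector A x (delta_mx 0 i)).
have [sh dh] := fun_with_differentialP (row_covector A x (delta_mx 0 j)).
have := Gg _ _ sf sh x; rewrite gamma_formE // gamma_form_mxE dual_metricE //.
by rewrite df dh !row_covectorK !mulmx_delta_trE.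
Qed.

Lemma local_gamma_mxE c x (i j : 'I_n) :
  local_gamma A P (coord_fun c i) (coord_fun c j) x =
  (dcoord_mx A c x *m gamma_mx x *m (dcoord_mx A c x)^T) i j.
Proof. by rewrite /local_gamma gamma_form_mxE [RHS]mulmx_trE !rowK. Qed.

Lemma gamma_coord_metricP g : riemannian_metric g ->
  (forall c, A c -> forall x, cdom c x -> forall i j : 'I_n,
     local_gamma A P (coord_fun c i) (coord_fun c j) x
     = invmx (gram_mx g c x) i j) <->
  (forall x, gamma_mx x = invmx (form_mx g x)).
Proof.
move=> gR; split=> [Gg x|Gg c Ac x cx i j].
  (* One chart around [x] is enough: its matrix [dcoord_mx] is invertible and cancels on both
     sides. *)
  have [Ac cx] := chart_atP smoothA x.
  set c := chart_at A x in Ac cx.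
  have EX := coord_mx_dual smoothA Ac cx.
  have := Gg c Ac x cx.
  rewrite gram_coord_mxE // (invmx_dual_basis (form_mx_unit gR x) EX) => GX.
  have {}GX : dcoord_mx A c x *m gamma_mx x *m (dcoord_mx A c x)^T =
      dcoord_mx A c x *m invmx (form_mx g x) *m (dcoord_mx A c x)^T.
    by apply/matrixP => i j; rewrite -local_gamma_mxE GX.
  have [_ uXT] := mulmx1_unit EX.
  have uX : dcoord_mx A c x \in unitmx by rewrite -unitmx_tr.
  exact: (can_inj (mulKmx uX)) (can_inj (mulmxK uXT) GX).
have EX := coord_mx_dual smoothA Ac cx.
by rewrite local_gamma_mxE gram_coord_mxE // (invmx_dual_basis (form_mx_unit gR x) EX) Gg.
Qed.

(** * The metric inverse to B_x, and its smoothness *)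

Definition gamma_metric : bilinear_form_field A :=
  fun x (u v : 'rV[R]_n) => (u *m invmx (gamma_mx x) *m v^T) 0 0.

Lemma form_mx_gamma_metric x : form_mx gamma_metric x = invmx (gamma_mx x).
Proof. by apply/matrixP => i j; rewrite mxE /gamma_metric mulmx_delta_trE. Qed.

(** The factors refer to [chart_at A (cinv c y)], chosen independently at each point, so they need
    not vary continuously; near each point the product is rewritten as J G^-1 J^T, whose factors are
    smooth. *)
Lemma smooth_gram_gamma_metric c : A c ->
  smooth_mx_on (cimg c) (fun y => coord_mx A c (cinv c y) *m
    invmx (gamma_mx (cinv c y)) *m (coord_mx A c (cinv c y))^T).
Proof.
move=> Ac i j k; apply: Ck_on_points => y0 cy0.
have oc := chart_open_img (atlas_chart smoothA Ac).
set x0 := cinv c y0.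
(* These functions depend on [y0], hence the reduction to single points. *)
pose f l := fun_with_differential (row_covector A x0 (delta_mx 0 l)).
have sf l : smooth_fun A (f l) by exact: (fun_with_differentialP _).1.
pose J y : 'M[R]_n := \matrix_(i, l) 'D_(delta_mx 0 i) (f l \o cinv c) y.
pose G y : 'M[R]_n := \matrix_(l, m) Gamma (f l) (f m) (cinv c y).
pose F x : 'M[R]_n := \matrix_(l < n) covector_row (dfun A (f l) x).
have JE y : cimg c y -> J y = coord_mx A c (cinv c y) *m (F (cinv c y))^T.
  move=> cy; have [yK cx] := cinvK smoothA Ac cy; apply/matrixP => a l.
  rewrite mxE -[coord_mx _ _ _]mulmx1 mulmx_trE !rowK mulmx1 -covectorE.
  rewrite dfun_coord_vec ?yK //; exact: smooth_differentiable_at.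
have GE y : G y = F (cinv c y) *m gamma_mx (cinv c y) *m (F (cinv c y))^T.
  by apply/matrixP => l m; rewrite mxE gamma_formE // gamma_form_mxE [RHS]mulmx_trE !rowK.
have sJ : smooth_mx_on (cimg c) J.
  move=> a l m; rewrite (_ : (fun y => _) = 'D_(delta_mx 0 a) (f l \o cinv c)).
    (* One derivative is lost: C^m for [J] comes from C^(m+1) for [f l]. *)
    exact: (sf l c Ac m.+1).2.
  by apply/funext => y; rewrite mxE.
have sG : smooth_mx_on (cimg c) G.
  move=> l m q; rewrite (_ : (fun y => _) = Gamma (f l) (f m) \o cinv c).
    exact: (gamma_smooth calculus).
  by apply/funext => y; rewrite mxE.
have uG0 : G y0 \in unitmx.
  suff -> : G y0 = gamma_mx x0 by exact: gamma_mx_unit.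
  (* At [x0] the differentials of the [f l] are exactly the dual basis. *)
  rewrite GE -/x0; suff -> : F x0 = 1%:M by rewrite trmx1 mulmx1 mul1mx.
  apply/row_matrixP => l; rewrite rowK (fun_with_differentialP _).2.
  by rewrite row_covectorK row1.
(* Open because [\det (G y)] is continuous on the image of the chart. *)
pose U := [set y | cimg c y /\ G y \in unitmx].
have oU : open U.
  rewrite openE => y [cy uy]; apply: filterI; first exact: open_nbhs_nbhs.
  have dety : \det (G y) != 0 by rewrite -unitfE -unitmxE.
  have cdet : {for y, continuous (fun y => \det (G y))}.
    exact: (smooth_mx_on_det oc sG 0%N).
  have : \forall z \near y, \det (G z) != 0.
    exact: cdet _ (open_nbhs_nbhs (conj (@open_neq _ 0) dety)).
  by apply: filterS => z; rewrite /= unitmxE unitfE.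
have subU : U `<=` cimg c by move=> y [].
have sJU := smooth_mx_on_subset subU sJ.
have sGU : smooth_mx_on U (fun y => invmx (G y)).
  apply: (smooth_mx_on_inv oU) => [y []//|].
  exact: (smooth_mx_on_subset subU sG).
have y0U : [set y0] `<=` U by move=> _ ->; split.
have sH := smooth_mx_on_mul oU (smooth_mx_on_mul oU sJU sGU) (smooth_mx_on_tr sJU).
apply: near_eq_Ck_on (Ck_on_subset y0U (sH i j k)).
move=> _ ->; have : \forall y \near y0, U y by exact: open_nbhs_nbhs.
apply: filterS => y [cy uy]; rewrite JE //; move: uy; rewrite GE => uy.
by rewrite invmx_change_basis.
Qed.

Lemma gamma_metric_riemannian : riemannian_metric gamma_metric.
Proof.
have Vsym x : (invmx (gamma_mx x))^T = invmx (gamma_mx x).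
  by rewrite trmx_inv gamma_mx_sym.
have lin x a (u v w : 'rV[R]_n) : gamma_metric (x := x) (a *: u + v) w =
    a * gamma_metric (x := x) u w + gamma_metric (x := x) v w.
  by rewrite /gamma_metric !mulmxDl -!scalemxAl !mxE.
have bsym x (u v : 'rV[R]_n) : gamma_metric (x := x) u v = gamma_metric (x := x) v u.
  (* A 1 x 1 matrix equals its transpose; transposing the product swaps [u] and [v]. *)
  rewrite /gamma_metric -[RHS](mxE trmx_key (fun i j => (v *m invmx (gamma_mx x) *m u^T) j i)).
  by rewrite -/(trmx _) !trmx_mul trmxK Vsym mulmxA.
split=> [x u v|x a u v w|x u u0|c Ac i j].
- exact: bsym.
- exact: lin.
(* With S = [gamma_mx x] and w = u S^-1, symmetry gives w S w^T = u S^-1 u^T, so positivity passes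
   to the inverse. *)
- have := @gamma_mx_posdef x ((u : 'rV[R]_n) *m invmx (gamma_mx x)).
  rewrite mulmxKV ?gamma_mx_unit // trmx_mul Vsym mulmxA; apply.
  apply: contraNneq u0 => u0; rewrite -[u](mulmxKV (gamma_mx_unit x)).
  by rewrite u0 mul0mx.
rewrite (_ : (fun y => _) = (fun y => (coord_mx A c (cinv c y) *m
  invmx (gamma_mx (cinv c y)) *m (coord_mx A c (cinv c y))^T) i j)).
  exact: smooth_gram_gamma_metric.
by apply/funext => y; rewrite mxE [RHS]mulmx_trE !rowK.
Qed.

Lemma gamma_metric_unique g : riemannian_metric g ->
  (forall x, gamma_mx x = invmx (form_mx g x)) -> gamma_metric = g.
Proof.
move=> gR Gg; apply: functional_extensionality_dep => x.
apply/funext => u; apply/funext => v.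
by rewrite /gamma_metric Gg invmxK metric_form_mxE.
Qed.

End gamma.

Theorem theorem4p1 (R : realType) (n : nat) (M : ptopologicalType)
    (A : set (chart R n M))
    (mu : {sigma_finite_measure set (borel M) -> \bar R})
    (P : R -> (M -> R) -> (M -> R)) :
  connected_smooth_manifold A ->
  diffusion_axioms A mu P ->
  smooth_diffusion_calculus A P ->
  gamma_form_posdef A P ->
  (exists! g : bilinear_form_field A,
     riemannian_metric g /\
     forall f h, smooth_fun A f -> smooth_fun A h ->
       forall x, carre_du_champ P f h x
                 = dual_metric g (dfun A f x) (dfun A h x)) /\
  (forall g : bilinear_form_field A, riemannian_metric g ->
     ((forall f h, smooth_fun A f -> smooth_fun A h ->
         forall x, carre_du_champ P f h x
                   = dual_metric g (dfun A f x) (dfun A h x))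
      <->
      (forall c, A c -> forall x, cdom c x -> forall i j : 'I_n,
         local_gamma A P (coord_fun c i) (coord_fun c j) x
         = invmx (gram_mx g c x) i j))).
Proof.
move=> manifoldA _ calculus posdef; have smoothA := manifold_smooth manifoldA.
have dualP g gR := @gamma_dual_metricP _ _ _ _ _ smoothA calculus posdef g gR.
split; last first.
  move=> g gR; apply: iff_trans (dualP g gR) _.
  exact: iff_sym (gamma_coord_metricP smoothA calculus posdef gR).
have gammaR := gamma_metric_riemannian smoothA calculus posdef.
exists (gamma_metric P); split.
  split; first exact: gammaR.
  apply/(dualP _ gammaR) => x.
  by rewrite form_mx_gamma_metric invmxK.
(* Any solution has [gamma_mx x] as inverse matrix at each [x], which determines it on all pairs of
   vectors. *)
by move=> g [gR /(dualP _ gR)]; exact: gamma_metric_unique.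
Qed.
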